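(* There is an absolute constant $K$ such that the following holds. Let $A,B$ be finite subsets of $\mathbb{R}$ and $\mathcal{P}:=A\times B$. Let $d,M\ge1$ and let $\mathcal{C}$ be a finite set of real algebraic curves in $\mathbb{R}^2$ of degree at most $d$ such that any two distinct points of $\mathcal{P}$ are contained in at most $M$ curves of $\mathcal{C}$. Assume that no curve in $\mathcal{C}$ contains a horizontal or vertical line, that $d^4|\mathcal{C}|\le M|\mathcal{P}|^2$, that $|A|\le|B|$, and that $d|\mathcal{C}|\ge M|B|^2/|A|$. Then $$|I(\mathcal{P},\mathcal{C})|\le K\, d^{2/3}M^{1/3}|\mathcal{P}|^{2/3}|\mathcal{C}|^{2/3}.$$
   Context: $I(\mathcal{P},\mathcal{C}):=\{(p,C)\in\mathcal{P}\times\mathcal{C}:p\in C\}$. A real algebraic curve in $\mathbb{R}^2$ is a real variety $Z_{\mathbb{R}^2}(f)=\{(x,y)\in\mathbb{R}^2: f(x,y)=0\}$, $f\in\mathbb{R}[x,y]$, of real dimension $1$ (isolated points allowed); its degree is the minimum degree of a polynomial $f$ with $C=Z_{\mathbb{R}^2}(f)$. *)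

(* Defs.v *)
From Stdlib Require Import Reals Lra List.
Import ListNotations.
Open Scope R_scope.

(* A real bivariate polynomial, as a finite list of monomials (i, j, c)
   standing for c * x^i * y^j. *)
Definition poly2 := list (nat * nat * R).

Definition eval2 (f : poly2) (x y : R) : R :=
  fold_right (fun t acc => let '(i, j, c) := t in c * x ^ i * y ^ j + acc) 0 f.

Definition zset (f : poly2) (x y : R) : Prop := eval2 f x y = 0.

Definition poly_deg_le (f : poly2) (d : nat) : Prop :=
  forall i j c, In (i, j, c) f -> c <> 0 -> (i + j <= d)%nat.

Definition same_zset (f g : poly2) : Prop :=
  forall x y, zset f x y <-> zset g x y.

(* Z(f) is a real algebraic curve: a real variety of real dimension 1.
   Dimension <= 1 iff Z(f) is not the whole plane (f not identically zero
   as a function); dimension >= 1 iff Z(f) is infinite. *)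
Definition is_real_curve (f : poly2) : Prop :=
  (exists x y, ~ zset f x y) /\
  ~ (exists l : list (R * R), forall x y, zset f x y -> In (x, y) l).

(* The curve Z(f) has degree at most d: some polynomial of degree <= d
   defines the same zero set (degree = minimum over defining polynomials). *)
Definition curve_deg_le (f : poly2) (d : nat) : Prop :=
  exists g, poly_deg_le g d /\ same_zset g f.

Definition contains_horizontal_line (f : poly2) : Prop :=
  exists c, forall x, zset f x c.
Definition contains_vertical_line (f : poly2) : Prop :=
  exists c, forall y, zset f c y.

Definition ind (r : R) : nat := if Req_EM_T r 0 then 1%nat else 0%nat.

Definition sumn (l : list nat) : nat := fold_right Nat.add 0%nat l.

Definition incidences (A B : list R) (fs : list poly2) : nat :=
  sumn (map (fun a => sumn (map (fun b =>
     sumn (map (fun f => ind (eval2 f a b)) fs)) B)) A).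

Definition curves_through2 (fs : list poly2) (p q : R * R) : nat :=
  length (filter (fun f =>
     if Req_EM_T (eval2 f (fst p) (snd p)) 0 then
       if Req_EM_T (eval2 f (fst q) (snd q)) 0 then true else false
     else false) fs).

Definition distinct_curves (fs : list poly2) : Prop :=
  forall i j, (i < length fs)%nat -> (j < length fs)%nat -> i <> j ->
    ~ same_zset (nth i fs []) (nth j fs []).

(* Main.v *)
(* Cut the plane by r+1 vertical and r+1 horizontal lines avoiding A x B into r^2 cells holding
   O(|A|/r) elements of A and O(|B|/r) elements of B.  A curve of degree d meets every line in at
   most d points, so it crosses the boundary of O(dr) cells.  In any other cell it visits, its
   polynomial h has a zero but none on the boundary; then for small e > 0 the function
   h^2 + e (x^(2d+2) + y^(2d+2)) has a critical point inside the cell.  These critical points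
   satisfy x^(2d+1) = p and y^(2d+1) = q with deg p, deg q <= 2d, so the functions on them are
   spanned by the (2d+1)^2 monomials of degree <= 2d in each variable, and there are at most
   (2d+1)^2 of them.  A curve with n points in a cell contributes at most
   1 + #{ordered pairs of distinct points}, hence I = O((dr + d^2) |C| + M |P|^2 / r^2), and the
   largest r with r^3 d |C| <= M |P|^2, which satisfies d <= r <= |A|, balances the terms. *)
Require Import Defs.
From Stdlib Require Import Reals List Lra.
Import ListNotations.
From mathcomp Require Import ssreflect ssrfun ssrbool.
From mathcomp Require all_boot all_order all_algebra ring lra zify.
From mathcomp Require boolp classical_sets reals topology normedtype derive realfun Rstruct.
Set Implicit Arguments. Unset Strict Implicit. Unset Printing Implicit Defensive.
Open Scope R_scope.

(** * Bivariate polynomial functions of bounded degree *)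

Section Grid.
Import all_boot all_order all_algebra ring lra zify boolp reals.
Import Order.TTheory GRing.Theory Num.Theory.
Local Open Scope ring_scope.

(** Generating these functions inductively, up to pointwise equality, lets degree bounds be proved
    by induction without a normal form for coefficients; [n] is only an upper bound. *)
Inductive polyfun (R : nzRingType) (n : nat) : (R -> R -> R) -> Prop :=
| polyfun_monomial i j c : (i + j <= n)%N ->
    polyfun n (fun x y => c * (x ^+ i * y ^+ j))
| polyfunD h k : polyfun n h -> polyfun n k ->
    polyfun n (fun x y => h x y + k x y)
| polyfun_ext h k : h =2 k -> polyfun n h -> polyfun n k.

Section PolyfunRing.
Variable R : comNzRingType.
Implicit Types (h k : R -> R -> R).

Lemma polyfun_cst n c : polyfun n (fun _ _ : R => c).
Proof.
by apply: polyfun_ext (polyfun_monomial c (leq0n n : (0 + 0 <= n)%N)) => x y;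
  rewrite !expr0 !mulr1.
Qed.

Lemma polyfun_fst n : (0 < n)%N -> polyfun n (fun x _ : R => x).
Proof.
move=> n0; apply: polyfun_ext (polyfun_monomial 1 (n0 : (1 + 0 <= n)%N)) => x y.
by rewrite expr0 expr1 mulr1 mul1r.
Qed.

Lemma polyfun_swap n h : polyfun n h -> polyfun n (fun x y => h y x).
Proof.
elim=> [i j c|h1 k1 _ + _|h1 k1 e _].
- rewrite addnC => ij; apply: polyfun_ext (polyfun_monomial c ij) => x y.
  by rewrite [y ^+ i * _]mulrC.
- exact: polyfunD.
- by apply: polyfun_ext => x y.
Qed.

Lemma polyfun_snd n : (0 < n)%N -> polyfun n (fun _ y : R => y).
Proof. by move=> /polyfun_fst/polyfun_swap. Qed.

Lemma polyfunM m n h k : polyfun m h -> polyfun n k ->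
  polyfun (m + n) (fun x y => h x y * k x y).
Proof.
move=> ph pk; elim: ph => [i j c ij|h1 h2 _ + _|h1 h2 e _]; last 2 first.
- by move=> p1 p2; apply: polyfun_ext (polyfunD p1 p2) => x y; rewrite mulrDl.
- by apply: polyfun_ext => x y; rewrite e.
elim: pk => [i' j' c' ij'|h1 h2 _ + _|h1 h2 e _].
- have H : (i + i' + (j + j') <= m + n)%N by lia.
  apply: polyfun_ext (polyfun_monomial (c * c') H) => x y.
  by rewrite !exprD; ring.
- by move=> p1 p2; apply: polyfun_ext (polyfunD p1 p2) => x y; rewrite mulrDr.
- by apply: polyfun_ext => x y; rewrite e.
Qed.

Lemma polyfunZ n c h : polyfun n h -> polyfun n (fun x y => c * h x y).
Proof. exact: (polyfunM (polyfun_cst 0 c)). Qed.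

Lemma polyfun_horner n h x : polyfun n h ->
  exists2 p : {poly R}, (size p <= n.+1)%N & forall y, h x y = p.[y].
Proof.
elim=> [i j c ij|h1 h2 _ [p sp ph] _ [q sq qh]|h1 h2 e _ [p sp ph]].
- exists ((c * x ^+ i) *: 'X^j); last by move=> y; rewrite hornerZ hornerXn mulrA.
  by rewrite (leq_trans (size_scale_leq _ _))// size_polyXn ltnS (leq_trans (leq_addl i j)).
- exists (p + q); last by move=> y; rewrite hornerD ph qh.
  by rewrite (leq_trans (size_polyD _ _))// geq_max sp.
- by exists p => // y; rewrite -e.
Qed.

End PolyfunRing.

(** * Counting the solutions of x^D = p, y^D = q *)

Section Separation.
Variables (R : realFieldType).
Implicit Types (h k : R -> R -> R) (s : seq (R * R)).

(** Multiply the squared distances to the points of [s]: over an ordered field each factor vanishes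
    at its own point only. *)
Lemma polyfun_separate s z : z \notin s ->
  exists n h, [/\ polyfun n h, h z.1 z.2 != 0 &
    forall w, w \in s -> h w.1 w.2 = 0].
Proof.
elim: s => [_|w s ih].
  by exists 0, (fun _ _ => 1); split=> //; [exact: polyfun_cst|exact: oner_neq0].
rewrite inE negb_or => /andP[zw /ih[n [h [ph hz hs]]]].
pose g x y := (x - w.1) * (x - w.1) + (y - w.2) * (y - w.2).
have pg : polyfun (1 + 1) g.
  have p1 : polyfun 1 (fun x _ : R => x - w.1).
    by apply: polyfunD; [exact: polyfun_fst|exact: polyfun_cst].
  have p2 : polyfun 1 (fun _ y : R => y - w.2).
    by apply: polyfunD; [exact: polyfun_snd|exact: polyfun_cst].
  by apply: polyfunD; apply: polyfunM.
exists (2 + n), (fun x y => g x y * h x y); split.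
- exact: polyfunM.
- rewrite mulf_neq0// /g -!expr2 paddr_eq0 ?sqr_ge0// !sqrf_eq0 !subr_eq0.
  by apply: contra zw; rewrite [z]surjective_pairing [w]surjective_pairing xpair_eqE.
- move=> v; rewrite inE => /predU1P[->|/hs->]; last by rewrite mulr0.
  by rewrite /g !subrr !mulr0 addr0 mul0r.
Qed.

(** On [s] the equations rewrite x^D and y^D in lower degree, so the D^2 monomials with both
    exponents below [D] span all polynomial functions on [s]. These separate points, hence form a
    space of dimension [size s]. *)
Lemma card_power_system (D n : nat) p q s : uniq s -> (n < D)%N ->
  polyfun n p -> polyfun n q ->
  {in s, forall z, z.1 ^+ D = p z.1 z.2 /\ z.2 ^+ D = q z.1 z.2} ->
  (size s <= D * D)%N.
Proof.
move=> us nD pp pq sys.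
pose spanned h := exists c : 'I_D * 'I_D -> R,
  {in s, forall z, h z.1 z.2 = \sum_u c u * (z.1 ^+ u.1 * z.2 ^+ u.2)}.
have spannedD h k : spanned h -> spanned k -> spanned (fun x y => h x y + k x y).
  move=> [c hc] [e ke]; exists (fun u => c u + e u) => z zs.
  rewrite hc// ke// -big_split/=; apply: eq_bigr => u _.
  by rewrite mulrDl.
have spanned_ext h k : {in s, forall z, k z.1 z.2 = h z.1 z.2} ->
    spanned h -> spanned k.
  by move=> e [c hc]; exists c => z zs; rewrite e// hc.
have spannedZ a h : spanned h -> spanned (fun x y => a * h x y).
  move=> [c hc]; exists (fun u => a * c u) => z zs.
  by rewrite hc// mulr_sumr; apply: eq_bigr => u _; rewrite mulrA.
have spanned_monomial i j : spanned (fun x y => x ^+ i * y ^+ j).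
  (* Induction on the total degree: trading x^D for [p], or y^D for [q], lowers it because n < D. *)
  have [t] := ubnP (i + j)%N; elim: t => // t ih in i j * => ijt.
  have reduce i' j' h : (i' + j' + n < i + j)%N -> polyfun n h ->
      spanned (fun x y => (x ^+ i' * y ^+ j') * h x y).
    move=> lt; elim=> [a b c ab|h1 h2 _ s1 _ s2|h1 h2 e _ s1].
    - apply: spanned_ext (spannedZ c _ (ih (i' + a)%N (j' + b)%N _)); last lia.
      by move=> z _; rewrite !exprD; ring.
    - by apply: spanned_ext (spannedD _ _ s1 s2) => z _; rewrite mulrDr.
    - by apply: spanned_ext s1 => z _; rewrite e.
  have [Di|iD] := leqP D i.
    apply: spanned_ext (reduce (i - D)%N j p _ pp); last lia.
    by move=> z zs; have [<- _] := sys z zs; rewrite mulrAC -exprD subnK.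
  have [Dj|jD] := leqP D j.
    apply: spanned_ext (reduce i (j - D)%N q _ pq); last lia.
    by move=> z zs; have [_ <-] := sys z zs; rewrite -mulrA -exprD subnK.
  exists (fun u => (u == (Ordinal iD, Ordinal jD))%:R) => z _.
  rewrite (bigD1 (Ordinal iD, Ordinal jD))//= eqxx mul1r big1 ?addr0// => u /negPf->.
  by rewrite mul0r.
have spanned_poly m h : polyfun m h -> spanned h.
  elim=> [i j c _|h1 h2 _ + _|h1 h2 e _ s1]; [exact: spannedZ|exact: spannedD|].
  by apply: spanned_ext s1 => z _; rewrite e.
pose P (k : 'I_(size s)) := nth (0, 0) s k.
have Ps (k : 'I_(size s)) : P k \in s by rewrite mem_nth.
(* The indicator of each point is spanned: rescale a polynomial that vanishes at all the other
   points. *)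
have sep (k : 'I_(size s)) : exists c : 'I_D * 'I_D -> R, forall l,
    (k == l)%:R = \sum_u c u * ((P l).1 ^+ u.1 * (P l).2 ^+ u.2).
  have /polyfun_separate[m [h [ph hk hs]]] : P k \notin rem (P k) s.
    by rewrite mem_rem_uniqF.
  have [c hc] := spannedZ (h (P k).1 (P k).2)^-1 _ (spanned_poly _ _ ph).
  exists c => l; rewrite -hc//; have [<-|kl] := eqVneq k l.
    by rewrite mulVf.
  have Pl : P l \in rem (P k) s.
    rewrite mem_rem_uniq// inE Ps andbT /P nth_uniq//.
    by rewrite eq_sym.
  by rewrite (hs _ Pl) mulr0.
have [c hc] := choice sep.
pose W := \matrix_(k < size s, u < #|{: 'I_D * 'I_D}|) c k (enum_val u).
pose V := \matrix_(u < #|{: 'I_D * 'I_D}|, l < size s)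
   ((P l).1 ^+ (enum_val u).1 * (P l).2 ^+ (enum_val u).2).
(* The identity of size [size s] factors through dimension D^2, which bounds its rank. *)
have /mulmx1_min : W *m V = 1%:M.
  apply/matrixP => k l; rewrite !mxE hc.
  rewrite [RHS](reindex _ (onW_bij _ (enum_val_bij _)))/=.
  by apply: eq_bigr => u _; rewrite !mxE.
by rewrite card_prod !card_ord.
Qed.
End Separation.

(** * Critical points in cells that a curve enters without meeting the boundary *)

Section CriticalPoints.
Import classical_sets topology normedtype derive realfun.
Import numFieldNormedType.Exports.
Local Open Scope classical_set_scope.
Variable R : realType.
Implicit Types (h k F w : R -> R -> R).

Lemma polyfun_continuous n h : polyfun n h ->
  continuous (fun z : R * R => h z.1 z.2).
Proof.
elim=> [i j c _|h1 h2 _ c1 _ c2|h1 h2 e _ c1] z.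
- have c1 : {for z, continuous (fun z : R * R => z.1 ^+ i)}.
    apply: (@continuous_comp _ _ _ fst (fun t : R => t ^+ i)); first exact: cvg_fst.
    exact: exprn_continuous.
  have c2 : {for z, continuous (fun z : R * R => z.2 ^+ j)}.
    apply: (@continuous_comp _ _ _ snd (fun t : R => t ^+ j)); first exact: cvg_snd.
    exact: exprn_continuous.
  exact: (cvgM (cvg_cst c) (cvgM c1 c2)).
- exact: (cvgD (c1 z) (c2 z)).
- rewrite (_ : (fun z => _) = (fun z => h1 z.1 z.2)); first exact: c1.
  by apply/funext => v; rewrite e.
Qed.

Lemma polyfun_derive n h : polyfun n h -> exists2 h', polyfun n h' &
  forall x y : R, is_derive x 1 (h ^~ y) (h' x y).
Proof.
elim=> [i j c ij|h1 h2 _ [k1 p1 d1] _ [k2 p2 d2]|h1 h2 e _ [k1 p1 d1]].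
- exists (fun x y => (c *+ i) * (x ^+ i.-1 * y ^+ j)).
    by apply: polyfun_monomial; lia.
  move=> x y; have := is_derive_poly ((c * y ^+ j) *: 'X^i) x.
  rewrite derivZ derivXn hornerZ hornerMn hornerXn.
  rewrite (_ : horner _ = (fun t => c * (t ^+ i * y ^+ j))).
    by move=> D; apply: is_derive_eq D _; rewrite -[c *+ i]mulr_natl -mulr_natl; ring.
  by apply/funext => t; rewrite hornerZ hornerXn mulrAC -mulrA.
- exists (fun x y => k1 x y + k2 x y); first exact: polyfunD.
  by move=> x y; exact: (is_deriveD (d1 x y) (d2 x y)).
- exists k1 => // x y; rewrite (_ : h2^~ y = h1^~ y)//.
  by apply/funext => t; rewrite e.
Qed.

(** The edges include the corners: compactness of the whole boundary is what gives a nonnegative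
    function a positive minimum there. *)
Record isolated h (u1 u2 v1 v2 : R) : Prop := Isolated {
  isolated_zero : exists x y, [/\ u1 < x < u2, v1 < y < v2 & h x y = 0];
  isolated_vert : forall y, v1 <= y <= v2 -> h u1 y != 0 /\ h u2 y != 0;
  isolated_hori : forall x, u1 <= x <= u2 -> h x v1 != 0 /\ h x v2 != 0 }.

(** [F] has a positive minimum on the compact boundary. For small [e] the perturbed value at the
    inner zero of [F] lies below it, so the minimum over the closed rectangle is attained inside. *)
Lemma isolated_min F w u1 u2 v1 v2 :
  continuous (fun z : R * R => F z.1 z.2) ->
  continuous (fun z : R * R => w z.1 z.2) ->
  (forall x y, 0 <= F x y) -> (forall x y, 0 <= w x y) ->
  isolated F u1 u2 v1 v2 ->
  exists2 e0, 0 < e0 & forall e, 0 < e <= e0 ->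
    exists x y, [/\ u1 < x < u2, v1 < y < v2 &
      forall x' y', u1 < x' < u2 -> v1 < y' < v2 ->
        F x y + e * w x y <= F x' y' + e * w x' y'].
Proof.
move=> cF cw F0 w0 [[x0 [y0 [x0u y0v Fz]]] bv bh].
have [u12 v12] : u1 <= u2 /\ v1 <= v2 by lra.
pose bd : set (R * R) := ([set u1; u2] `*` `[v1, v2]) `|` (`[u1, u2] `*` [set v1; v2]).
have cbd : compact bd.
  by apply: compactU; apply: compact_setX; rewrite ?set_itvE;
    do ?[exact: segment_compact | apply: compactU; exact: compact_set1].
have bd0 : bd !=set0.
  by exists (u1, v1); left; split; [left|rewrite /= in_itv/= lexx v12].
have [m mbd mmin] := compact_EVT_min bd0 cbd (continuous_subspaceT cF).
have m0 : 0 < F m.1 m.2.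
  rewrite lt0r F0 andbT; move: mbd; rewrite inE => -[] [].
    by move=> [->|->]; rewrite /= in_itv/= => /bv[].
  by rewrite /= in_itv/= => /bh[] + + [->|->].
(* Adding 1 keeps the denominator positive and makes the bound [ew] strict for every e <= e0. *)
pose e0 := F m.1 m.2 / (w x0 y0 + 1).
have w1 : 0 < w x0 y0 + 1 by rewrite ltr_wpDl.
exists e0 => [|e /andP[egt0 ele]]; first exact: divr_gt0.
have ew : e * w x0 y0 < F m.1 m.2.
  apply: (@lt_le_trans _ _ (e * (w x0 y0 + 1))).
    by rewrite ltr_pM2l// ltrDl.
  by rewrite -ler_pdivlMr.
pose G (z : R * R) := F z.1 z.2 + e * w z.1 z.2.
have cG : continuous G.
  by move=> z; apply: cvgD; [exact: cF|apply: cvgM; [exact: cvg_cst|exact: cw]].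
pose Q : set (R * R) := `[u1, u2] `*` `[v1, v2].
have Q0 : Q (x0, y0) by split; rewrite /= in_itv/=; lra.
have cQ : compact Q by apply: compact_setX; exact: segment_compact.
have [c] := compact_EVT_min (ex_intro _ _ Q0) cQ (continuous_subspaceT cG).
rewrite inE => -[/= cu cv] cmin.
have Gc : G c < F m.1 m.2.
  apply: le_lt_trans (cmin _ (mem_set Q0)) _.
  by rewrite /G/= Fz add0r.
have nbd : ~ bd c.
  move=> /mem_set/mmin; apply/negP; rewrite -ltNge; apply: le_lt_trans Gc.
  by rewrite lerDl mulr_ge0// ltW.
move: (cu) (cv); rewrite !in_itv/= => /andP[lu gu] /andP[lv gv].
exists c.1, c.2; split.
- rewrite !lt_neqAle lu gu !andbT; apply/andP; split; apply/eqP => E; apply: nbd;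
    left; (split; last exact: cv); [by left|by right].
- rewrite !lt_neqAle lv gv !andbT; apply/andP; split; apply/eqP => E; apply: nbd;
    right; (split; first exact: cu); [by left|by right].
- move=> x' y' xu yv; apply: (cmin (x', y')); rewrite inE.
  by split; rewrite /= in_itv/=; lra.
Qed.

Lemma is_derive_min (f : R -> R) a b c df : a < c < b -> (forall t, derivable f t 1) ->
  (forall t, a < t < b -> f c <= f t) -> is_derive c 1 f df -> df = 0.
Proof.
move=> acb fd cmin fdf; have ab : a <= b by lra.
have := @derive1_at_min _ f a b c ab (fun t _ => fd t).
rewrite in_itv/= => /(_ acb) H; rewrite -(@derive_val _ _ _ _ _ _ _ fdf).
apply: (@derive_val _ _ _ _ _ _ _ (H _)) => t; rewrite in_itv; exact: cmin.
Qed.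

(** The first-order condition in one variable. Only [x'] moves, so the condition in the other
    variable follows by exchanging the coordinates. *)
Lemma perturbed_min_derive n (e : R) F F' u1 u2 x y :
  (forall x y : R, is_derive x 1 (F ^~ y) (F' x y)) ->
  u1 < x < u2 ->
  (forall x', u1 < x' < u2 ->
     F x y + e * (x ^+ n.+1 + y ^+ n.+1) <= F x' y + e * (x' ^+ n.+1 + y ^+ n.+1)) ->
  e * n.+1%:R * x ^+ n = - F' x y.
Proof.
move=> dF xu xmin.
pose p : {poly R} := e *: ('X^(n.+1) + (y ^+ n.+1)%:P).
have pE t : p.[t] = e * (t ^+ n.+1 + y ^+ n.+1).
  by rewrite hornerZ hornerD hornerXn hornerC.
have dG t := is_deriveD (dF t y) (is_derive_poly p t).
have Gmin t : u1 < t < u2 -> (F ^~ y \+ horner p) x <= (F ^~ y \+ horner p) t.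
  by move=> tu; rewrite /= !pE; exact: xmin.
have := is_derive_min xu (fun t => @ex_derive _ _ _ _ _ _ _ (dG t)) Gmin (dG x).
rewrite derivZ derivD derivXn derivC addr0 hornerZ hornerMn hornerXn.
by move=> /eqP; rewrite addrC addr_eq0 => /eqP <-; rewrite -[_ ^+ n *+ _]mulr_natl mulrA.
Qed.

(* The even powers [x ^+ (2d+2) + y ^+ (2d+2)] perturb [h ^ 2] so that the top-degree
   forms of the two partial derivatives are pure powers, to which
   [card_power_system] applies whatever [h] is. *)
Lemma card_isolated (T : finType) (Z : {set T}) d h (u1 u2 v1 v2 : T -> R) :
  polyfun d h ->
  {in Z, forall t, isolated h (u1 t) (u2 t) (v1 t) (v2 t)} ->
  {in Z &, forall t t' x y, u1 t < x < u2 t -> v1 t < y < v2 t ->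
     u1 t' < x < u2 t' -> v1 t' < y < v2 t' -> t = t'} ->
  (#|Z| <= (d + d).+1 * (d + d).+1)%N.
Proof.
move=> ph iso disj.
(* D = 2d+1 exceeds the degree 2d of h^2, as [card_power_system] requires, and D+1 is even, so [w]
   is nonnegative. *)
set D := (d + d).+1; pose F x y := h x y * h x y.
pose w (x y : R) := x ^+ D.+1 + y ^+ D.+1.
have pF : polyfun (d + d) F by exact: polyfunM.
have pw : polyfun D.+1 w.
  apply: polyfunD.
    by apply: polyfun_ext (polyfun_monomial 1 (_ : D.+1 + 0 <= D.+1)%N) => [x y|];
      rewrite ?expr0 ?mulr1 ?mul1r ?addn0.
  by apply: polyfun_ext (polyfun_monomial 1 (_ : 0 + D.+1 <= D.+1)%N) => [x y|];
    rewrite ?expr0 ?mul1r.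
have w0 x y : 0 <= w x y.
  have even_ge0 (t : R) : 0 <= t ^+ D.+1.
    by rewrite /D addnn -doubleS -muln2 exprM sqr_ge0.
  by rewrite addr_ge0.
have isoF t : t \in Z -> isolated F (u1 t) (u2 t) (v1 t) (v2 t).
  move=> /iso[[x [y [xu yv h0]]] hv hh]; split.
  - by exists x, y; split=> //; rewrite /F h0 mul0r.
  - by move=> y' /hv; rewrite !mulf_eq0 !orbb.
  - by move=> x' /hh; rewrite !mulf_eq0 !orbb.
have minF t tZ := isolated_min (polyfun_continuous pF) (polyfun_continuous pw)
  (fun x y => sqr_ge0 (h x y)) w0 (isoF t tZ).
have /choice[e0 e0P] t : exists e0, 0 < e0 /\ (t \in Z -> forall e, 0 < e <= e0 ->
    exists x y, [/\ u1 t < x < u2 t, v1 t < y < v2 t &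
      forall x' y', u1 t < x' < u2 t -> v1 t < y' < v2 t ->
        F x y + e * w x y <= F x' y' + e * w x' y']).
  have [tZ|tZ] := boolP (t \in Z); last by exists 1; split.
  by have [e e0 eP] := minF t tZ; exists e; split.
(* A common [e] makes the critical points of all cells solve one and the same system; 1 is the value
   when [Z] is empty. *)
pose e := \big[Num.min/1]_(t in Z) e0 t.
have egt0 : 0 < e.
  rewrite /e; elim/big_ind: _ => // [x y x0 y0|t _]; first by rewrite lt_min x0 y0.
  by case: (e0P t).
have /choice[c cP] t : exists c : R * R, t \in Z ->
    [/\ u1 t < c.1 < u2 t, v1 t < c.2 < v2 t &
      forall x' y', u1 t < x' < u2 t -> v1 t < y' < v2 t ->
        F c.1 c.2 + e * w c.1 c.2 <= F x' y' + e * w x' y'].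
  have [tZ|tZ] := boolP (t \in Z); last by exists (0, 0).
  have [_ /(_ tZ e)] := e0P t; rewrite egt0 bigmin_le_cond//.
  by move=> /(_ isT)[x [y xy]]; exists (x, y).
have [F1 pF1 dF1] := polyfun_derive pF.
(* [F2] differentiates [F] with its arguments exchanged, which is why [q2] reads [F2 y x]. *)
have [F2 pF2 dF2] := polyfun_derive (polyfun_swap pF).
have eD : e * D.+1%:R != 0 by rewrite mulf_neq0 ?gt_eqF.
pose q1 x y := - (e * D.+1%:R)^-1 * F1 x y.
pose q2 x y := - (e * D.+1%:R)^-1 * F2 y x.
have c_inj : {in enum Z &, injective c}.
  move=> t t'; rewrite !mem_enum => tZ t'Z ctt'.
  have [xu yv _] := cP t tZ; have [xu' yv' _] := cP t' t'Z.
  by apply: (disj t t' tZ t'Z) xu yv _ _; rewrite ctt'.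
have us : uniq [seq c t | t <- enum Z] by rewrite map_inj_in_uniq ?enum_uniq.
have := @card_power_system R D (d + d) q1 q2 _ us.
rewrite size_map -cardE; apply => //.
- exact: polyfunZ.
- exact/polyfunZ/polyfun_swap.
move=> z /mapP[t]; rewrite mem_enum => /cP[xu yv cmin] ->; split.
  have := perturbed_min_derive dF1 xu (fun x' x'u => cmin x' (c t).2 x'u yv).
  by move=> E; rewrite /q1 mulNr -mulrN -E mulKf.
have := @perturbed_min_derive D e _ _ _ _ (c t).2 (c t).1 dF2 yv.
move=> E; rewrite /q2 mulNr -mulrN -E ?mulKf// => y' y'v.
by have := cmin (c t).1 y' xu y'v; rewrite /w ![(c t).1 ^+ _ + _]addrC.
Qed.

End CriticalPoints.

(** * Cutting a finite set into strips, and counting strips that contain roots *)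

Section Cuts.
Variable R : realFieldType.
Implicit Types (A s : seq R).

Lemma cut_sorted (x : R) s k : path <%R x s -> (k <= size s)%N ->
  exists t, [/\ x < t, t \notin s & count (< t) s = k].
Proof.
elim: s x k => [|y s ih] x k /=.
  by rewrite leqn0 => _ /eqP->; exists (x + 1); rewrite ltrDl ltr01.
move=> /andP[xy ys]; case: k => [_|k ks].
  have /allP sy := order_path_min lt_trans ys.
  exists ((x + y) / 2); split; first lra.
    rewrite inE negb_or; apply/andP; split; first by apply/eqP; lra.
    by apply/negP => /sy; lra.
  rewrite [_ < _](_ : _ = false); last by apply/negP; lra.
  by apply/eqP; rewrite -leqn0 leqNgt -has_count; apply/hasPn => z /sy; rewrite -leNgt; lra.
have [t [yt ts ct]] := ih y k ys ks; exists t; split.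
- exact: lt_trans yt.
- by rewrite inE negb_or ts gt_eqF.
- by rewrite yt ct.
Qed.

Lemma cut_exists A k : uniq A -> (k <= size A)%N ->
  exists2 t, t \notin A & count (< t) A = k.
Proof.
move=> uA kA; pose s := sort <=%R A.
have sA : perm_eq s A by rewrite perm_sort.
have ps : path <%R (head 0 s - 1) s.
  have : sorted <%R s by rewrite sort_lt_sorted.
  by case: (s) => //= x s' ->; rewrite andbT gtrBl ltr01.
have [|t [_ ts ct]] := cut_sorted ps (_ : k <= size s)%N.
  by rewrite size_sort.
exists t; first by rewrite -(perm_mem sA).
by rewrite -(seq.permP sA).
Qed.

(** Cut at the ranks floor(i n / r), where n = |A|. As r <= n, these ranks strictly increase, and a
    strip holds fewer than n/r + 1 <= 2n/r elements. *)
Lemma cut_grid A r : uniq A -> (0 < r <= size A)%N ->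
  exists (u : nat -> R) (cell : R -> 'I_r),
  [/\ forall i j, (i < j <= r)%N -> u i < u j,
      {in A, forall a, u (cell a) < a < u (cell a).+1} &
      forall i, (r * count (fun a => cell a == i) A <= 2 * size A)%N].
Proof.
move=> uA /andP[r0 rA]; set n := size A.
have /choice[u uP] i : exists t, (i <= r)%N -> t \notin A /\ count (< t) A = (i * n %/ r)%N.
  have [ir|ri] := leqP i r; last by exists 0.
  have [|t tA ct] := @cut_exists A (i * n %/ r) uA; last by exists t.
  by rewrite -/n -{2}(mulKn n r0) leq_div2r// leq_mul2r ir orbT.
have cu i : (i <= r)%N -> count (< u i) A = (i * n %/ r)%N by case/uP.
have uA' i a : (i <= r)%N -> a \in A -> a != u i.
  by case/uP => uiA _ aA; apply: contraNneq uiA => <-.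
have mono i j : (i < j <= r)%N -> u i < u j.
  move=> /andP[ij jr]; rewrite ltNge; apply/negP => uji.
  have : (count (< u j) A <= count (< u i) A)%N.
    by apply: sub_count => a /= au; exact: lt_le_trans uji.
  rewrite !cu//; last by rewrite (leq_trans (ltnW ij)).
  apply/negP; rewrite -ltnNge; apply: (@leq_trans ((i * n + r) %/ r)).
    by rewrite divnDr// divnn r0 addn1.
  by apply: leq_div2r; rewrite (leq_trans (_ : _ <= i.+1 * n)%N) ?leq_mul2r ?ij ?orbT// mulSn; lia.
have cellP a : exists i : 'I_r, a \in A -> u i < a < u i.+1.
  have [aA|] := boolP (a \in A); last by exists (Ordinal r0).
  have u0a : u 0%N < a.
    rewrite ltNge le_eqVlt negb_or uA'//=; apply/negP => au.
    have := cu 0%N (leq0n r); rewrite mul0n div0n => /eqP.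
    by rewrite -leqn0 leqNgt -has_count => /hasPn/(_ _ aA)/negP.
  have aur : a < u r.
    have := cu r (leqnn r); rewrite mulKn// => /eqP.
    by rewrite -all_count => /allP/(_ _ aA).
  (* The strip of [a] starts at the last cut below [a]. *)
  have ex : exists i, (i <= r)%N && (u i < a) by exists 0%N.
  have ub i : (i <= r)%N && (u i < a) -> (i <= r)%N by case/andP.
  case: (ex_maxnP ex ub) => i /andP[ir uia] imax.
  have ilt : (i < r)%N.
    rewrite ltn_neqAle ir andbT; apply/eqP => E; move: uia; rewrite E => ?; lra.
  exists (Ordinal ilt) => _ /=; rewrite uia/= ltNge le_eqVlt negb_or.
  rewrite eq_sym uA'//=; apply/negP => uSa.
  by have := imax i.+1; rewrite ilt uSa ltnn => /(_ isT).
have /choice[cell cP] := cellP.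
exists u, cell; split=> // i.
have : (count (fun a => cell a == i) A + count (< u i) A <= count (< u i.+1) A)%N.
  rewrite -count_predUI [X in (_ + X)%N](_ : _ = 0%N) ?addn0.
    rewrite (@eq_in_count _ _ (predI (predU (fun a => cell a == i) (< u i)) (mem A)));
      last by move=> a aA /=; rewrite aA andbT.
    apply: sub_count => a /= /andP[/orP[/eqP <-|ua] aA].
      by have /andP[] := cP a aA.
    by apply: lt_trans (mono i i.+1 _); rewrite ?ltnSn ?ltn_ord.
  apply/eqP; rewrite -leqn0 leqNgt -has_count; apply/hasPn => a aA /=.
  by apply/andP => -[/eqP <-]; have := cP a aA; lra.
rewrite !cu// ?(ltnW (ltn_ord i))// => le.
have h1 := leq_trunc_div (i.+1 * n) r.
have h2 := ltn_ceil (i * n) r0.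
have : (r * (count (fun a => cell a == i) A + i * n %/ r) <= r * (i.+1 * n %/ r))%N.
  by rewrite leq_mul2l le orbT.
move: h1 h2; rewrite -/n; set q1 := (i * n %/ r)%N; set q2 := (i.+1 * n %/ r)%N.
by move: q1 q2 (count _ _) => q1 q2 k; nia.
Qed.

Lemma card_disjoint_roots (p : {poly R}) d r (J : {set 'I_r}) (y : 'I_r -> R) :
  p != 0 -> (size p <= d.+1)%N -> {in J, forall j, root p (y j)} ->
  {in J &, injective y} -> (#|J| <= d)%N.
Proof.
move=> p0 sp yr yi.
have us : uniq [seq y j | j <- enum J].
  rewrite map_inj_in_uniq ?enum_uniq// => i j; rewrite !mem_enum; exact: yi.
have rs : all (root p) [seq y j | j <- enum J].
  by apply/allP => _ /mapP[j jJ ->]; apply: yr; rewrite mem_enum in jJ.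
have := max_poly_roots p0 rs us; rewrite size_map -cardE => lt.
by rewrite -ltnS (leq_trans lt).
Qed.

Lemma strip_inj r (w : nat -> R) (i j : 'I_r) x y :
  (forall i j, (i < j <= r)%N -> w i < w j) ->
  w i <= x < w i.+1 -> w j <= y < w j.+1 -> x = y -> i = j.
Proof.
move=> mono xi yj xy; apply: val_inj.
have ltS (k l : 'I_r) : (k < l)%N -> w k.+1 <= w l.
  rewrite leq_eqVlt => /predU1P[<-//|kl]; apply/ltW/mono.
  by rewrite kl ltnW.
case: (ltngtP i j) => // /ltS wS; exfalso; move: xi yj wS; rewrite xy.
  by move=> /andP[_ yi] /andP[jy _] ij; have := lt_le_trans yi (le_trans ij jy); rewrite ltxx.
by move=> /andP[jy _] /andP[_ yi] ij; have := lt_le_trans yi (le_trans ij jy); rewrite ltxx.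
Qed.

(** A root at a cut point can lie in two adjacent closed intervals, hence the factor 2: [J1]
    collects the half-open intervals with a root and [J2] the intervals with a root at the right
    end, each at most [d] many. *)
Lemma card_closed_intervals_roots (p : {poly R}) d r (v : nat -> R) :
  p != 0 -> (size p <= d.+1)%N -> (forall i j, (i < j <= r)%N -> v i < v j) ->
  (#|[set j : 'I_r | `[< exists y, v j <= y <= v j.+1 /\ p.[y] = 0 >]]%R| <= 2 * d)%N.
Proof.
move=> p0 sp mono.
pose J1 := [set j : 'I_r | `[< exists y, v j <= y < v j.+1 /\ p.[y] = 0 >]].
pose J2 := [set j : 'I_r | p.[v j.+1] == 0].
have J1d : (#|J1| <= d)%N.
  have /choice[y yP] (j : 'I_r) : exists y, j \in J1 -> v j <= y < v j.+1 /\ p.[y] = 0.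
    have [jJ|] := boolP (j \in J1); last by exists 0.
    by move: (jJ); rewrite in_set => /asboolP[y]; exists y.
  apply: (@card_disjoint_roots p d r J1 y) => // [j /yP[_ /eqP]//|i j iJ jJ yij].
  by have [yi _] := yP i iJ; have [yj _] := yP j jJ; exact: strip_inj mono yi yj yij.
have J2d : (#|J2| <= d)%N.
  apply: (@card_disjoint_roots p d r J2 (fun j => v j.+1)) => // [j|i j _ _ vij].
    by rewrite inE.
  apply: val_inj; case: (ltngtP i j) => // ij; exfalso; move: vij => /eqP.
    by rewrite lt_eqF// mono// ltnS ij ltn_ord.
  by rewrite gt_eqF// mono// ltnS ij ltn_ord.
rewrite mul2n -addnn (leq_trans _ (leq_add J1d J2d))//.
rewrite (leq_trans (subset_leq_card _) (leq_card_setU J1 J2).1)//.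
apply/subsetP => j; rewrite in_setU !in_set => /asboolP[y [/andP[vy]]].
rewrite le_eqVlt => /predU1P[-> /eqP->|yv py]; first by rewrite orbT.
by apply/orP; left; apply/asboolP; exists y; rewrite vy yv.
Qed.

End Cuts.

(** * Cells visited by one curve *)

Section Cells.
Variable R : realType.
Implicit Types h : R -> R -> R.

Lemma card_pairs_rows r m (V : {set 'I_r * 'I_r}) :
  (forall i, (#|[set j | (i, j) \in V]| <= m)%N) -> (#|V| <= r * m)%N.
Proof.
move=> Vm; rewrite -sum1_card.
rewrite (eq_bigl (fun z : 'I_r * 'I_r => (z.1, z.2) \in V)); last by case.
rewrite -(pair_big_dep xpredT (fun i j => (i, j) \in V) (fun _ _ => 1%N))/=.
rewrite -[X in (_ <= X * _)%N]card_ord -sum_nat_const leq_sum// => i _.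
apply: leq_trans (Vm i); rewrite -sum1_card.
by rewrite [leqRHS](eq_bigl (fun j => (i, j) \in V)) // => j; rewrite inE.
Qed.

(** Each of the [r] lines x = c(i) carries at most [d] roots. With [c] arbitrary, the lemma serves
    left and right edges alike and, after exchanging coordinates, the horizontal ones. *)
Lemma card_boundary_cells d h r (c : 'I_r -> R) (v : nat -> R) : polyfun d h ->
  (forall x, exists y, h x y != 0) -> (forall i j, (i < j <= r)%N -> v i < v j) ->
  (#|[set z : 'I_r * 'I_r |
      `[< exists y, v z.2 <= y <= v z.2.+1 /\ h (c z.1) y = 0 >]]%R| <= r * (2 * d))%N.
Proof.
move=> ph nz mono; apply: card_pairs_rows => i.
have [p sp hp] := polyfun_horner (c i) ph.
have p0 : p != 0.
  by have [y] := nz (c i); rewrite hp; apply: contraNneq => ->; rewrite horner0.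
apply: leq_trans (card_closed_intervals_roots p0 sp mono).
apply/subset_leq_card/subsetP => j; rewrite !in_set => /asboolP[y [yv]].
by rewrite hp => py; apply/asboolP; exists y.
Qed.

(** A visited cell is isolated unless the curve meets one of its four closed edges; each kind of
    edge accounts for at most 2dr cells. *)
Lemma card_visited_cells d h r (u v : nat -> R) : polyfun d h ->
  (forall x, exists y, h x y != 0) -> (forall y, exists x, h x y != 0) ->
  (forall i j, (i < j <= r)%N -> u i < u j) ->
  (forall i j, (i < j <= r)%N -> v i < v j) ->
  (#|[set z : 'I_r * 'I_r | `[< exists x y, [/\ u z.1 < x < u z.1.+1,
        v z.2 < y < v z.2.+1 & h x y = 0] >]]%R|
     <= (d + d).+1 * (d + d).+1 + 8 * (d * r))%N.
Proof.
move=> ph nzv nzh mu mv.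
pose Z := [set z : 'I_r * 'I_r | `[< isolated h (u z.1) (u z.1.+1) (v z.2) (v z.2.+1) >]].
(* Taking [c] to be [id] or [succn] selects the left or right edges in [V], the bottom or top edges
   in [H]. *)
pose V (c : nat -> nat) := [set z : 'I_r * 'I_r |
  `[< exists y, v z.2 <= y <= v z.2.+1 /\ h (u (c z.1)) y = 0 >]].
pose H (c : nat -> nat) := [set z : 'I_r * 'I_r |
  `[< exists x, u z.1 <= x <= u z.1.+1 /\ h x (v (c z.2)) = 0 >]].
have Vd c : (#|V c| <= r * (2 * d))%N.
  exact: (card_boundary_cells (fun i => u (c i)) ph nzv mv).
have Hd c : (#|H c| <= r * (2 * d))%N.
  apply: leq_trans (card_boundary_cells (fun i => v (c i)) (polyfun_swap ph) nzh mu).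
  pose sw (z : 'I_r * 'I_r) := (z.2, z.1).
  have sw_inj : injective sw by move=> [a b] [a' b'] [-> ->].
  rewrite -(card_imset _ sw_inj); apply/subset_leq_card/subsetP => _ /imsetP[z + ->].
  by rewrite !in_set.
have Zd : (#|Z| <= (d + d).+1 * (d + d).+1)%N.
  have sep (w : nat -> R) (i j : 'I_r) x : (forall i j, (i < j <= r)%N -> w i < w j) ->
      w i < x < w i.+1 -> w j < x < w j.+1 -> i = j.
    move=> mw /andP[/ltW xi1 xi2] /andP[/ltW xj1 xj2].
    by apply: (strip_inj mw _ _ (erefl x)); apply/andP.
  apply: (@card_isolated _ _ Z d h (fun z => u z.1) (fun z => u z.1.+1)
    (fun z => v z.2) (fun z => v z.2.+1) ph) => [z|[i j] [i' j'] _ _ x y /= xi yj xi' yj'].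
    by rewrite in_set => /asboolP.
  by rewrite (sep u i i' x)// (sep v j j' y).
have : (#|(Z :|: (V id :|: V succn)) :|: (H id :|: H succn)|
   <= (d + d).+1 * (d + d).+1 + 8 * (d * r))%N.
  have cU := leq_card_setU.
  have [a _] := cU _ (Z :|: (V id :|: V succn)) (H id :|: H succn).
  have [b _] := cU _ Z (V id :|: V succn).
  have [e _] := cU _ (V id) (V succn).
  have [f _] := cU _ (H id) (H succn).
  have := Vd id; have := Vd succn; have := Hd id; have := Hd succn.
  move: Zd a b e f; rewrite [(r * _)%N]mulnC -mulnA.
  set t := (d * r)%N; set t2 := ((d + d).+1 * _)%N; lia.
apply: leq_trans; apply/subset_leq_card/subsetP => z; rewrite in_set => /asboolP vis.
apply: contraT; rewrite !in_setU !negb_or => /andP[/andP[nZ /andP[nV0 nV1]] /andP[nH0 nH1]].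
move: nZ nV0 nV1 nH0 nH1; rewrite !in_set.
move=> /asboolP nZ /asboolP nV0 /asboolP nV1 /asboolP nH0 /asboolP nH1.
case: nZ; split=> //.
- by move=> y yv; split; apply/eqP => hy; [apply: nV0|apply: nV1]; exists y.
- by move=> x xu; split; apply/eqP => hx; [apply: nH0|apply: nH1]; exists x.
Qed.

End Cells.

(** * From visited cells to incidences *)

Lemma size_le_image_collisions (X T : eqType) (g : X -> T) (L : seq X) : uniq L ->
  (size L <= size (undup (map g L)) +
     \sum_(p <- L) \sum_(q <- L) ((p != q) && (g p == g q)))%N.
Proof.
elim: L => //= x L ih /andP[xL uL].
rewrite !big_cons/= eqxx add0n.
(* If some [y] already occupies the class of [x], the ordered pair (x, y) pays for [x]; otherwise
   the image gains an element. *)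
have [/mapP[y yL gy]|gx] := boolP (g x \in map g L).
  rewrite (bigD1_seq y)//= gy eqxx andbT (_ : x != y); last first.
    by apply: contraNneq xL => ->.
  apply: (@leq_trans (size (undup (map g L)) +
    \sum_(p <- L) \sum_(q <- L) ((p != q) && (g p == g q))).+1); first by rewrite ltnS ih.
  rewrite -addnS leq_add2l -[X in (_ <= X)%N]addnA add1n ltnS.
  apply: leq_trans (leq_addl _ _); apply: leq_sum => p _.
  by rewrite big_cons leq_addl.
rewrite addSn ltnS (leq_trans (ih uL))// leq_add2l.
apply: leq_trans (leq_addl _ _); apply: leq_sum => p _.
by rewrite big_cons leq_addl.
Qed.

Section Incidences.
Variable R : realType.

(** [S] counts the ordered pairs of grid points in a common cell. The points on a curve number at
    most its visited cells plus the collisions among them; summed over the curves, each pair of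
    distinct points is charged at most [M] times. *)
Lemma grid_incidences (A B : seq R) d r m M (f : 'I_m -> R -> R -> R) :
  uniq A -> uniq B -> (0 < r <= size A)%N -> (r <= size B)%N ->
  (forall k, polyfun d (f k)) ->
  (forall k x, exists y, f k x y != 0) -> (forall k y, exists x, f k x y != 0) ->
  {in allpairs pair A B &, forall p q, p != q ->
     (\sum_(k < m) ((f k p.1 p.2 == 0%R) && (f k q.1 q.2 == 0%R)) <= M)%N} ->
  exists2 S, (r ^ 2 * S <= 4 * (size A * size B) ^ 2)%N &
    (\sum_(a <- A) \sum_(b <- B) \sum_(k < m) (f k a b == 0%R) <=
      m * ((d + d).+1 * (d + d).+1 + 8 * (d * r)) + M * S)%N.
Proof.
move=> uA uB rA rB pf nzv nzh fM.
have r0 : (0 < r)%N by case/andP: rA.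
have [u [al [mu cu nu]]] := cut_grid uA rA.
have [|v [be [mv cv nv]]] := @cut_grid _ B r uB; first by rewrite r0.
pose g (p : R * R) := (al p.1, be p.2).
set P := allpairs pair A B.
have uP : uniq P.
  by apply: allpairs_uniq => // -[a b] [a' b'] _ _ [-> ->].
exists (\sum_(p <- P) \sum_(q <- P) (g p == g q))%N.
  rewrite -(size_allpairs pair A B) -/P -[in leqRHS]mulnn mulnA.
  rewrite -[X in (_ <= _ * X)%N]sum1_size !big_distrr/=.
  apply: leq_sum => -[a b] _; rewrite muln1.
  (* A cell is a product of two strips, so it holds at most (2|A|/r)(2|B|/r) points. *)
  have -> : (\sum_(q <- P) (g (a, b) == g q) =
      count (fun a' => al a' == al a) A * count (fun b' => be b' == be b) B)%N.
    rewrite big_allpairs -!sum1_count big_distrl/= [RHS]big_mkcond/=.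
    apply: eq_bigr => a' _; rewrite mul1n [X in if _ then X else _]big_mkcond/=.
    have [e|ne] := eqVneq.
      by apply: eq_bigr => b' _; rewrite /g/= xpair_eqE e eqxx/= eq_sym; case: eqP.
    by rewrite big1// => b' _; rewrite xpair_eqE eq_sym (negPf ne).
  have := leq_mul (nu (al a)) (nv (be b)); rewrite size_allpairs.
  by congr leq; ring.
have -> : (\sum_(a <- A) \sum_(b <- B) \sum_(k < m) (f k a b == 0%R) =
    \sum_(p <- P) \sum_(k < m) (f k p.1 p.2 == 0%R))%N by rewrite big_allpairs.
rewrite exchange_big/= -[m in (m * _)%N]card_ord -sum_nat_const.
pose L k := [seq p <- P | f k p.1 p.2 == 0].
have Lk k : ((\sum_(p <- P) (f k p.1 p.2 == 0%R) <=
   ((d + d).+1 * (d + d).+1 + 8 * (d * r)) +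
   \sum_(p <- L k) \sum_(q <- L k) ((p != q) && (g p == g q)))%N).
  have -> : (\sum_(p <- P) (f k p.1 p.2 == 0%R) = size (L k))%N.
    by rewrite size_filter -sum1_count [RHS]big_mkcond; apply: eq_bigr => p _; case: eqP.
  apply: leq_trans (size_le_image_collisions g (filter_uniq _ uP)) _.
  rewrite leq_add2r.
  apply: leq_trans (card_visited_cells (pf k) (nzv k) (nzh k) mu mv).
  rewrite -(card_uniqP (undup_uniq _)); apply/subset_leq_card/subsetP => z.
  rewrite mem_undup => /mapP[[a b]]; rewrite mem_filter => /andP[/eqP fab].
  move=> /allpairsP[[a' b'] /= [aA bB [? ?]]]; subst a' b' => ->.
  by rewrite inE; apply/asboolP; exists a, b; split; [exact: cu|exact: cv|].
apply: leq_trans (leq_sum _ (fun k _ => Lk k)) _.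
rewrite big_split/= leq_add2l.
have LP k : (\sum_(p <- L k) \sum_(q <- L k) ((p != q) && (g p == g q)) =
    \sum_(p <- P) \sum_(q <- P) ((p != q) && (g p == g q)) *
       ((f k p.1 p.2 == 0%R) && (f k q.1 q.2 == 0%R)))%N.
  rewrite big_filter big_mkcond; apply: eq_bigr => p _.
  have [fp|fp] := eqVneq; last by rewrite big1 // => q _; rewrite muln0.
  rewrite big_filter big_mkcond; apply: eq_bigr => q _ /=.
  by case: (f k q.1 q.2 == 0%R); rewrite ?muln1 ?muln0.
rewrite (eq_bigr _ (fun k _ => LP k)) exchange_big/= big_distrr/=.
rewrite big_seq [leqRHS]big_seq; apply: leq_sum => p pP.
rewrite exchange_big/= big_distrr/= big_seq [leqRHS]big_seq; apply: leq_sum => q qP.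
rewrite -big_distrr/=; have [->|pq] := eqVneq p q; first by rewrite mul0n.
by rewrite /= mulnC leq_mul2r fM// orbT.
Qed.

(** Take the largest [r] with r^3 d m <= X. The first size hypothesis says that [d] qualifies, so d
    <= r; the second forces r <= |A|. Keeping [r] in the conclusion postpones fractional powers to
    the end. *)
Lemma incidences_bound (A B : seq R) d m M (f : 'I_m -> R -> R -> R) :
  uniq A -> uniq B -> (0 < size A <= size B)%N -> (0 < d)%N -> (0 < m)%N ->
  (forall k, polyfun d (f k)) ->
  (forall k x, exists y, f k x y != 0) -> (forall k y, exists x, f k x y != 0) ->
  {in allpairs pair A B &, forall p q, p != q ->
     (\sum_(k < m) ((f k p.1 p.2 == 0%R) && (f k q.1 q.2 == 0%R)) <= M)%N} ->
  (d ^ 4 * m <= M * (size A * size B) ^ 2)%N ->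
  (M * size B ^ 2 <= d * m * size A)%N ->
  exists2 r, (r ^ 3 * (d * m) <= M * (size A * size B) ^ 2)%N &
    (\sum_(a <- A) \sum_(b <- B) \sum_(k < m) (f k a b == 0%R) <= 49 * (d * r * m))%N.
Proof.
move=> uA uB /andP[A0 AB] d0 m0 pf nzv nzh fM hd hA.
set X := (M * (size A * size B) ^ 2)%N.
have Pd : (d ^ 3 * (d * m) <= X)%N by rewrite mulnA -expnSr.
have ub r : (r ^ 3 * (d * m) <= X)%N -> (r <= size A)%N.
  move=> rX; rewrite -(leq_exp2r _ _ (isT : (0 < 3)%N)).
  have dm : (0 < d * m)%N by rewrite muln_gt0 d0.
  rewrite -(leq_pmul2r dm); apply: leq_trans rX _.
  have -> : X = (M * size B ^ 2 * size A ^ 2)%N by rewrite /X expnMn; lia.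
  have -> : (size A ^ 3 * (d * m) = d * m * size A * size A ^ 2)%N by rewrite !expnS; lia.
  by rewrite leq_mul2r hA orbT.
case: (ex_maxnP (ex_intro (fun r => r ^ 3 * (d * m) <= X)%N d Pd) ub) => r rX rmax.
have dr : (d <= r)%N by apply: rmax.
have rA : (r <= size A)%N := ub r rX.
exists r => //.
have r0 : (0 < r)%N := leq_trans d0 dr.
have Xr : (X < r.+1 ^ 3 * (d * m))%N.
  by rewrite ltnNge; apply/negP => /rmax; rewrite ltnn.
have [||S hS hI] := grid_incidences uA uB _ _ pf nzv nzh fM (r := r).
- by rewrite r0.
- exact: leq_trans AB.
apply: leq_trans hI _.
(* 17 = 9 + 8, from (2d+1)^2 <= 9 d^2 <= 9dr. *)
have cells : (m * ((d + d).+1 * (d + d).+1 + 8 * (d * r)) <= 17 * (d * r * m))%N.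
  have : ((d + d).+1 * (d + d).+1 <= 9 * (d * r))%N.
    apply: (@leq_trans (9 * (d * d))); first nia.
    by rewrite leq_mul2l leq_mul2l dr orbT.
  move=> h; apply: (@leq_trans (m * (17 * (d * r)))); last lia.
  by rewrite leq_mul2l; apply/orP; right; lia.
(* 32 = 4 times 8: the 4 comes from [hS], the 8 from X < (r+1)^3 dm <= 8 r^3 dm. *)
have MS : (M * S <= 32 * (d * r * m))%N.
  have r2 : (0 < r ^ 2)%N by rewrite expn_gt0 r0.
  rewrite -(leq_pmul2l r2).
  have h1 : (r ^ 2 * (M * S) <= 4 * X)%N by rewrite /X; nia.
  apply: leq_trans h1 _.
  have h2 : (r.+1 ^ 3 <= 8 * r ^ 3)%N.
    by rewrite -[8%N]/(2 ^ 3)%N -expnMn leq_exp2r//; lia.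
  have h3 : (X <= 8 * r ^ 3 * (d * m))%N.
    by apply: leq_trans (ltnW Xr) _; rewrite leq_mul2r h2 orbT.
  have -> : (r ^ 2 * (32 * (d * r * m)) = 4 * (8 * r ^ 3 * (d * m)))%N.
    by rewrite !expnS; lia.
  by rewrite leq_mul2l h3 orbT.
by lia.
Qed.

End Incidences.

End Grid.

(** * Transfer to Stdlib reals, lists and curves *)

Section Cartesian.
Import all_boot all_order all_algebra boolp reals Rstruct.
Import Order.TTheory GRing.Theory Num.Theory.
Local Open Scope ring_scope.
Local Notation R := Rdefinitions.R.

Lemma InP (T : eqType) (x : T) s : reflect (In x s) (x \in s).
Proof.
elim: s => [|y s ih]; first by right.
rewrite inE; apply: (iffP orP) => -[e|h].
- by left; rewrite (eqP e).
- by right; apply/ih.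
- by left; rewrite e.
- by right; apply/ih.
Qed.

Lemma NoDup_uniq (T : eqType) (s : seq T) : NoDup s -> uniq s.
Proof. by elim=> //= x s' /InP-> _ ->. Qed.

Lemma sumn_map (T : Type) (F : T -> nat) s : Defs.sumn (List.map F s) = (\sum_(x <- s) F x)%N.
Proof. by elim: s => [|x s ih]; rewrite ?big_nil ?big_cons //= ih. Qed.

Lemma ind_eq0 (x : R) : Defs.ind x = (x == 0).
Proof. by rewrite /Defs.ind; case: RIneq.Req_EM_T => [->|/eqP/negPf->]//; rewrite eqxx. Qed.

Lemma curves_through2E fs (p q : R * R) : curves_through2 fs p q =
  (\sum_(f <- fs) ((eval2 f p.1 p.2 == 0%R) && (eval2 f q.1 q.2 == 0%R)))%N.
Proof.
elim: fs => [|f fs ih]; first by rewrite big_nil.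
rewrite big_cons -ih /curves_through2 /=.
case: RIneq.Req_EM_T => [->|/eqP/negPf->] //; rewrite eqxx.
by case: RIneq.Req_EM_T => [->|/eqP/negPf->] //; rewrite eqxx.
Qed.

Lemma polyfun_eval2 g d : poly_deg_le g d -> polyfun d (eval2 g : R -> R -> R).
Proof.
elim: g => [|[[i j] c] g ih] dg; first exact: polyfun_cst.
have pg : polyfun d (eval2 g) by apply: ih => i' j' c' gc; apply: dg; right.
have pm : polyfun d (fun x y : R => c * (x ^+ i * y ^+ j)).
  (* [poly_deg_le] allows any exponents on a term with coefficient 0; such a term is replaced by the
     constant 0. *)
  have [->|/eqP c0] := eqVneq c 0.
    by apply: polyfun_ext (polyfun_cst d 0) => x y; rewrite mul0r.
  by apply: polyfun_monomial; apply/ssrnat.leP; apply: dg c0; left.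
apply: polyfun_ext (polyfunD pm pg) => x y.
by rewrite mulrA /= !RpowE.
Qed.

Lemma Nat_powE a n : Nat.pow a n = (a ^ n)%N.
Proof. by elim: n => //= n ->; rewrite expnS. Qed.

(** The division by |A| is cleared here, whence the guard on the last hypothesis. *)
Lemma incidences_poly2_bound (A B : list R) (d M : nat) (fs : list poly2) :
  NoDup A -> NoDup B -> (0 < d)%N ->
  (forall f, In f fs -> curve_deg_le f d) ->
  (forall p q, In p.1 A -> In p.2 B -> In q.1 A -> In q.2 B ->
     p <> q -> (curves_through2 fs p q <= M)%coq_nat) ->
  (forall f, In f fs -> ~ contains_horizontal_line f /\ ~ contains_vertical_line f) ->
  (Nat.pow d 4 * length fs <= M * Nat.pow (length A * length B) 2)%coq_nat ->
  (length A <= length B)%coq_nat ->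
  ((0 < length A)%N -> (M * Nat.pow (length B) 2 <= d * length fs * length A)%coq_nat) ->
  exists2 r, (Nat.pow r 3 * (d * length fs) <= M * Nat.pow (length A * length B) 2)%coq_nat &
    (incidences A B fs <= 49%N * (d * r * length fs))%coq_nat.
Proof.
move=> /NoDup_uniq uA /NoDup_uniq uB d0 degf thr lines.
rewrite !Nat_powE => /ssrnat.leP hd /ssrnat.leP hAB hA.
pose m := size fs; pose F (k : 'I_m) := nth [::] fs k.
have incE : incidences A B fs =
    (\sum_(a <- A) \sum_(b <- B) \sum_(k < m) (eval2 (F k) a b == 0%R))%N.
  rewrite /incidences sumn_map; apply: eq_bigr => a _; rewrite sumn_map.
  apply: eq_bigr => b _; rewrite sumn_map (big_nth [::]) big_mkord.
  by apply: eq_bigr => k _; rewrite ind_eq0.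
(* The witness r = 0 settles the cases of empty [A] and of no curves. *)
have trivial0 : incidences A B fs = 0%N -> exists2 r,
    (Nat.pow r 3 * (d * length fs) <= M * (length A * length B) ^ 2)%coq_nat &
    (incidences A B fs <= 49%N * (d * r * length fs))%coq_nat.
  by move=> ->; exists 0%N; apply/ssrnat.leP.
have [A0|A0] := posnP (size A).
  by apply: trivial0; rewrite incE (size0nil A0) big_nil.
have [m0|m0] := posnP m.
  apply: trivial0; rewrite incE big1// => a _; rewrite big1// => b _.
  by rewrite big1 // => -[k km]; exfalso; rewrite m0 in km.
have FIn k : In (F k) fs by apply/InP; rewrite mem_nth.
(* Incidences depend on zero sets only, so each curve may be given by a defining polynomial of
   degree at most [d]. *)
have /choice[g gP] k : exists g, poly_deg_le g d /\ same_zset g (F k).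
  exact: degf (FIn k).
pose f k : R -> R -> R := eval2 (g k).
have fE k a b : (f k a b == 0) = (eval2 (F k) a b == 0).
  have [_ /(_ a b) gF] := gP k; by apply/eqP/eqP => /gF.
have nzv k x : exists y, f k x y != 0.
  have [_ nv] := lines _ (FIn k); apply: contra_notP nv => nz; exists x => y.
  have [_ /(_ x y) gF] := gP k; apply/gF; apply: contra_notP nz => /eqP fxy.
  by exists y.
have nzh k y : exists x, f k x y != 0.
  have [nh _] := lines _ (FIn k); apply: contra_notP nh => nz; exists y => x.
  have [_ /(_ x y) gF] := gP k; apply/gF; apply: contra_notP nz => /eqP fxy.
  by exists x.
have fM : {in allpairs pair A B &, forall p q, p != q ->
    (\sum_(k < m) ((f k p.1 p.2 == 0%R) && (f k q.1 q.2 == 0%R)) <= M)%N}.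
  move=> p q /allpairsP[[a b] /= [/InP aA /InP bB ->]].
  move=> /allpairsP[[a' b'] /= [/InP aA' /InP bB' ->]] /eqP pq.
  have /ssrnat.leP := thr (a, b) (a', b') aA bB aA' bB' pq.
  rewrite curves_through2E (big_nth [::]) big_mkord; congr (_ <= _)%N.
  by apply: eq_bigr => k _; rewrite /= !fE.
have hA' : (M * size B ^ 2 <= d * m * size A)%N.
  exact/ssrnat.leP/hA.
have [|r rX rI] := incidences_bound uA uB _ d0 m0 (fun k => polyfun_eval2 (gP k).1)
  nzv nzh fM hd hA'; first by rewrite A0.
exists r; first by rewrite Nat_powE; apply/ssrnat.leP.
apply/ssrnat.leP; rewrite incE; apply: leq_trans rI.
apply: leq_sum => a _; apply: leq_sum => b _; apply: leq_sum => k _.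
by rewrite fE.
Qed.
End Cartesian.

(** * Fractional powers and the final estimate *)

Lemma Rpower_two_thirds_pow3 (n : nat) : INR n ^ 2 <= Rpower (INR n) (2 / 3) ^ 3.
Proof.
(* At n = 0 [Rpower] is still a value of [exp], hence positive, so only an inequality holds. *)
case: n => [|n].
  by rewrite pow_ne_zero //; apply: pow_le; apply: Rlt_le; exact: exp_pos.
have n0 : 0 < INR (S n) by apply: lt_0_INR; apply: Nat.lt_0_succ.
rewrite -(Rpower_pow 3); last exact: exp_pos.
rewrite Rpower_mult (_ : 2 / 3 * INR 3 = INR 2); last by rewrite /=; lra.
by rewrite Rpower_pow //; exact: Rle_refl.
Qed.

Lemma Rpower_third_pow3 (n : nat) : INR n <= Rpower (INR n) (1 / 3) ^ 3.
Proof.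
case: n => [|n]; first by apply: pow_le; apply: Rlt_le; exact: exp_pos.
have n0 : 0 < INR (S n) by apply: lt_0_INR; apply: Nat.lt_0_succ.
rewrite -(Rpower_pow 3); last exact: exp_pos.
rewrite Rpower_mult (_ : 1 / 3 * INR 3 = 1); last by rewrite /=; lra.
by rewrite Rpower_1 //; exact: Rle_refl.
Qed.

Lemma Rle_pow3 (x y : R) : 0 <= y -> x ^ 3 <= y ^ 3 -> x <= y.
Proof.
move=> y0 xy; apply: Rnot_lt_le => yx; have x0 : 0 < x by lra.
have : y ^ 3 < x ^ 3; last lra.
have -> : x ^ 3 = x * x * x by ring.
have -> : y ^ 3 = y * y * y by ring.
have yx2 : y * y <= x * x by apply: Rmult_le_compat; lra.
by apply: Rle_lt_trans (Rmult_le_compat_r _ _ _ y0 yx2) _; apply: Rmult_lt_compat_l => //; nra.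
Qed.

Theorem theorem2p1 :
  exists K : R,
  forall (A B : list R) (d M : nat) (fs : list poly2),
    NoDup A -> NoDup B ->
    (1 <= d)%nat -> (1 <= M)%nat ->
    distinct_curves fs ->
    (forall f, In f fs -> is_real_curve f /\ curve_deg_le f d) ->
    (forall p q, In (fst p) A -> In (snd p) B -> In (fst q) A -> In (snd q) B ->
       p <> q -> (curves_through2 fs p q <= M)%nat) ->
    (forall f, In f fs -> ~ contains_horizontal_line f /\ ~ contains_vertical_line f) ->
    (d ^ 4 * length fs <= M * (length A * length B) ^ 2)%nat ->
    (length A <= length B)%nat ->
    INR (d * length fs) >= INR (M * length B ^ 2) / INR (length A) ->
    INR (incidences A B fs) <=
      K * Rpower (INR d) (2/3) * Rpower (INR M) (1/3)
        * Rpower (INR (length A * length B)) (2/3)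
        * Rpower (INR (length fs)) (2/3).
Proof.
exists 49 => A B d M fs uA uB d1 _ _ curves through lines hd hAB hA.
have hA' : (0 < length A)%nat -> (M * length B ^ 2 <= d * length fs * length A)%nat.
  move=> /lt_0_INR A0; apply: INR_le; rewrite (mult_INR _ (length A)).
  apply: (Rmult_le_reg_r (/ INR (length A))); first exact: Rinv_0_lt_compat.
  rewrite Rmult_assoc Rinv_r ?Rmult_1_r; last lra.
  exact: Rge_le.
have [r rX rI] := incidences_poly2_bound uA uB (introT ssrnat.leP d1)
  (fun f fin => (curves f fin).2) through lines hd hAB
  (fun A0 => hA' (elimT ssrnat.leP A0)).
apply: Rle_trans (le_INR _ _ rI) _.
have := Rpower_two_thirds_pow3 d; have := Rpower_third_pow3 M.
have := Rpower_two_thirds_pow3 (length A * length B).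
have := Rpower_two_thirds_pow3 (length fs).
move: rX => /le_INR; rewrite (mult_INR (r ^ 3)) (mult_INR M) (mult_INR d) !(pow_INR _ 3).
rewrite !(pow_INR _ 2) (mult_INR 49) (mult_INR (d * r)) (mult_INR d r) (mult_INR (length A)).
have pos x y : 0 <= Rpower x y by apply: Rlt_le; exact: exp_pos.
move: (pos (INR d) (2/3)) (pos (INR M) (1/3)) (pos (INR (length A) * INR (length B)) (2/3))
  (pos (INR (length fs)) (2/3)).
rewrite (_ : INR 49 = 49); last by rewrite INR_IZR_INZ.
move: (Rpower (INR d) _) (Rpower (INR M) _) (Rpower (INR (length A) * _) _)
  (Rpower (INR (length fs)) _) => td tM tP tm.
move: (pos_INR d) (pos_INR M) (pos_INR (length fs)) (pos_INR r).
move: (INR d) (INR M) (INR (length fs)) (INR r) (INR (length A) * INR (length B))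
  => x M' m s P x0 M0 m0 s0 td0 tM0 tP0 tm0 rX hm hP hM hd'.
(* Comparing cubes removes the fractional powers: with [x] for d and [s] for r, (d r m)^3 = (r^3 d
   m)(d^2 m^2) <= (M P^2)(d^2 m^2). *)
have le3 : x * s * m <= td * tM * tP * tm.
  apply: Rle_pow3; first by do 3 (apply: Rmult_le_pos => //).
  have -> : (x * s * m) ^ 3 = (s ^ 3 * (x * m)) * (x ^ 2 * m ^ 2) by ring.
  have -> : (td * tM * tP * tm) ^ 3 = (tM ^ 3 * tP ^ 3) * (td ^ 3 * tm ^ 3) by ring.
  apply: Rmult_le_compat.
  - by apply: Rmult_le_pos; [apply: pow_le|apply: Rmult_le_pos].
  - by apply: Rmult_le_pos; apply: pow2_ge_0.
  - by apply: Rle_trans rX _; apply: Rmult_le_compat => //; apply: pow2_ge_0.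
  - by apply: Rmult_le_compat => //; apply: pow2_ge_0.
lra.
Qed.
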